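(* Let $h:\mathfrak g^*\to\mathbb R$ be a (reduced) Hamiltonian function. The Morse family $$E^{h\to l}=\Delta-h(\mu)=\langle\mu,\xi\rangle-h(\mu)$$ on the bundle $\mathfrak g\times\mathfrak g^*\to\mathfrak g$ generates the Lagrangian submanifold $$s'_{\mathfrak z_d}=\left\{\left(ad^*_{\frac{\delta h}{\delta\mu}}\mu,\ \mu,\ \frac{\delta h}{\delta\mu}\right)\in\mathfrak z_d:\ \mu\in\mathfrak g^*\right\}$$ of the reduced Tulczyjew symplectic space $(\mathfrak z_d=\mathcal O_\lambda\times\mathfrak g^*\times\mathfrak g,\ \Omega_{\mathfrak z_d})$.
   Context: $G$ is a Lie group with Lie algebra $\mathfrak g$, assumed reflexive, and dual $\mathfrak g^*$. With $I_g(h)=g^{-1}hg$, put $Ad_g=T_eI_g$ (right adjoint action); $ad_\xi\eta=[\xi,\eta]$ is its infinitesimal version. $Ad^*_g$ is defined by $\langle Ad^*_g\mu,\xi\rangle=\langle\mu,Ad_{g^{-1}}\xi\rangle$, and $ad^*_\xi$ by $\langle ad^*_\xi\mu,\eta\rangle=\langle\mu,[\xi,\eta]\rangle$. $\mathcal O_\lambda$ is the coadjoint orbit through $\lambda\in\mathfrak g^*$. $\delta h/\delta\mu\in\mathfrak g^{**}=\mathfrak g$ is the derivative of $h$ at $\mu$. The set $s'_{\mathfrak z_d}$ defines the Lie-Poisson equations $\frac{d\mu}{dt}=ad^*_{\frac{\delta h}{\delta\mu}}\mu$. Points of $\mathfrak z_d=\mathcal O_\lambda\times\mathfrak g^*\times\mathfrak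 g$ are written $(Ad^*_{g^{-1}}\lambda,\mu,\xi)$, and $\tau_{\mathfrak z_d}:\mathfrak z_d\to\mathfrak g$ is the projection to $\xi$. For $\eta,\zeta\in\mathfrak g$, $\upsilon\in\mathfrak g^*$ there is the vector field on $\mathfrak z_d$ $$X_{(\eta,\upsilon,\zeta)}(Ad^*_{g^{-1}}\lambda,\mu,\xi)=\left(ad^*_\eta\circ Ad^*_{g^{-1}}\lambda,\ \upsilon+ad^*_\eta\mu,\ \zeta+[\xi,\eta]\right).$$ The exact symplectic form $\Omega_{\mathfrak z_d}=d\chi_1=d\chi_2$ and its potential one-forms are given at $(Ad^*_{g^{-1}}\lambda,\mu,\xi)$ by $$\Omega_{\mathfrak z_d}(X_{(\eta,\upsilon,\zeta)},X_{(\bar\eta,\bar\upsilon,\bar\zeta)})=\langle\upsilon,\bar\zeta\rangle-\langle\bar\upsilon,\zeta\rangle-\langle\lambda,[\eta,\bar\eta]\rangle,$$ $$\langle\chi_1,X_{(\eta,\upsilon,\zeta)}\rangle=\langle\lambda,\eta\rangle-\langle\upsilon,\xi\rangle,\qquad\langle\chi_2,X_{(\eta,\upsilon,\zeta)}\rangle=\langle\lambda,\eta\rangle+\langle\mu,\zeta\rangle.$$ The function $\Delta=\langle\mu,\xi\rangle$ satisfies $\chi_2-\chi_1=d\Delta$. The canonically symplectic space $T^*\mathfrak g=\mathfrak g\times\mathfrak g^*$ is embedded symplectically in $\mathfrak z_d$ by $\hat\varkappa:T^*\mathfrak g\to\mathfrak z_d$, $\hat\varkappa(\xi,\mu)=(ad^*_\xi\mu,\mu,\xi)$.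 That $E^{h\to l}$ generates $s'_{\mathfrak z_d}$ means that it generates a Lagrangian submanifold $s_{T^*\mathfrak g}$ of $T^*\mathfrak g$, consisting of the pairs $(\delta h/\delta\mu,\mu)$, which $\hat\varkappa$ maps to $s'_{\mathfrak z_d}$. Morse families: for a fibre bundle $\pi:\mathcal P\to\mathcal M$, let $V\mathcal P=\ker T\pi$ and let $V^0\mathcal P\subset T^*\mathcal P$ be the covectors annihilating $V\mathcal P$. A function $E:\mathcal P\to\mathbb R$ is a Morse family if $T_z\,\mathrm{im}(dE)+T_zV^0\mathcal P=T_zT^*\mathcal P$ for all $z\in\mathrm{im}(dE)\cap V^0\mathcal P$. It generates the immersed Lagrangian submanifold of $T^*\mathcal M$ consisting of the covectors $\lambda_{\mathcal M}$ at points $\pi(p)$ with $T^*\pi(\lambda_{\mathcal M})=dE(p)$, $p\in\mathcal P$.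
   Formalization: That s' is Lagrangian for the form on z_d is not claimed (false for SO(3), λ≠0, h linear): the Lagrangian property is stated for the pairs (δh/δμ, μ) in T*g; since κ̂ need not land in z_d, it maps to g*×g*×g, and s' is the part of the image in z_d. *)

(* Defs.v *)
From HB Require Import structures.
From mathcomp Require Import all_boot all_order all_algebra.
From mathcomp Require Import all_classical all_reals all_analysis.

Set Implicit Arguments.
Unset Strict Implicit.
Unset Printing Implicit Defensive.
Import Order.TTheory GRing.Theory Num.Theory.
Import numFieldNormedType.Exports.
Local Open Scope classical_set_scope.
Local Open Scope ring_scope.

Section ContinuousLinear.
Context (R : realType) (U V : normedModType R).

Definition clinear_pred : {pred U -> V} :=
  [pred f | `[< linear f /\ continuous f >]].

Record clinear := CLinear { clinear_fun :> U -> V;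
                            _ : clinear_fun \in clinear_pred }.

HB.instance Definition _ := [isSub for clinear_fun].
HB.instance Definition _ := [Choice of clinear by <:].

Fact clinear_pred_submod : submod_closed clinear_pred.
Proof.
split=> [|a f g /asboolP[flin fcont] /asboolP[glin gcont]]; apply/asboolP; split.
- by move=> a x y; rewrite /= scaler0 addr0.
- by move=> x; exact: cst_continuous.
- move=> b x y; rewrite !fctE flin glin !scalerDr addrACA; congr (_ + _).
  by rewrite !scalerA mulrC.
- move=> x; apply: (@cvgD _ _ _ (nbhs x) _ (a \*: f) g (a *: f x) (g x)).
    by apply: cvgZl_tmp; exact: fcont.
  exact: gcont.
Qed.
HB.instance Definition _ :=
  GRing.isSubmodClosed.Build R (U -> V) clinear_pred clinear_pred_submod.
HB.instance Definition _ := [SubChoice_isSubLmodule of clinear by <:].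

Lemma clinear_is_linear (f : clinear) : linear f.
Proof. by case: f => f /= /asboolP[]. Qed.
HB.instance Definition _ (f : clinear) :=
  GRing.isLinear.Build R U V *:%R (clinear_fun f) (clinear_is_linear f).

Lemma clinear_continuous (f : clinear) : continuous f.
Proof. by case: f => f /= /asboolP[]. Qed.

Lemma clinearP (f g : clinear) : f =1 g -> f = g.
Proof. by move=> fg; apply/val_inj/funext. Qed.

Definition op_norm (f : clinear) : R :=
  sup [set `|f x| | x in [set x : U | `|x| <= 1]].

Lemma clinear_bound (f : clinear) :
  exists2 M, 0 <= M & forall x, `|f x| <= M * `|x|.
Proof.
have /linear_boundedP : bounded_near f (nbhs (0 : U)).
  by apply: continuous_linear_bounded; exact: clinear_continuous.
move=> [M [_ /(_ (Num.max M 0 + 1)) fM]]; exists (Num.max M 0 + 1).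
  by rewrite addr_ge0// le_max lexx orbT.
by apply: fM; rewrite ltr_pwDr// le_max lexx.
Qed.

Lemma op_norm_has_sup (f : clinear) :
  has_sup [set `|f x| | x in [set x : U | `|x| <= 1]].
Proof.
split; first by exists `|f 0|, 0 => //=; rewrite normr0.
have [M M0 fM] := clinear_bound f; exists M => _ [x /= x1 <-].
by rewrite (le_trans (fM x))// ler_piMr.
Qed.

Lemma op_norm_ub (f : clinear) x : `|x| <= 1 -> `|f x| <= op_norm f.
Proof.
by move=> x1; apply: sup_upper_bound; [exact: op_norm_has_sup|exists x].
Qed.

Lemma op_norm_le (f : clinear) (M : R) :
  (forall x, `|x| <= 1 -> `|f x| <= M) -> op_norm f <= M.
Proof.
move=> fM; apply: ge_sup; first by have [] := op_norm_has_sup f.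
by move=> _ [x /= x1 <-]; exact: fM.
Qed.

Lemma op_norm_ge0 (f : clinear) : 0 <= op_norm f.
Proof. by rewrite (le_trans _ (@op_norm_ub f 0 _)) ?normr0. Qed.

Lemma op_normP (f : clinear) x : `|f x| <= op_norm f * `|x|.
Proof.
have [->|x0] := eqVneq x 0; first by rewrite linear0 !normr0 mulr0.
have nx : 0 < `|x| by rewrite normr_gt0.
rewrite -ler_pdivrMr//.
have -> : `|f x| / `|x| = `|f (`|x|^-1 *: x)|.
  by rewrite linearZ normrZ normfV normr_id mulrC.
by apply: op_norm_ub; rewrite normrZ normfV normr_id mulVf ?gt_eqF.
Qed.

Fact op_normD (f g : clinear) : op_norm (f + g) <= op_norm f + op_norm g.
Proof.
apply: op_norm_le => x x1.
by rewrite (le_trans (ler_normD _ _))// lerD// op_norm_ub.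
Qed.

Fact op_normZ (a : R) (f : clinear) : op_norm (a *: f) = `|a| * op_norm f.
Proof.
have le b g : op_norm (b *: g) <= `|b| * op_norm g.
  by apply: op_norm_le => x x1; rewrite normrZ ler_wpM2l// op_norm_ub.
apply/eqP; rewrite eq_le le/=.
have [->|a0] := eqVneq a 0; first by rewrite normr0 mul0r op_norm_ge0.
have := le a^-1 (a *: f); rewrite scalerA mulVf// scale1r normfV.
by rewrite ler_pdivlMl ?normr_gt0.
Qed.

Fact op_norm0_eq0 (f : clinear) : op_norm f = 0 -> f = 0.
Proof.
move=> f0; apply: clinearP => x; apply/normr0_eq0/eqP.
by rewrite eq_le normr_ge0 andbT (le_trans (op_normP f x))// f0 mul0r.
Qed.

HB.instance Definition _ :=
  Lmodule_isNormed.Build R clinear op_normD op_normZ op_norm0_eq0.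

End ContinuousLinear.

Notation "{ 'clinear' U -> V }" := (clinear U V)
  (at level 0, U at level 98, V at level 99,
   format "{ 'clinear'  U  ->  V }") : type_scope.
Notation dual R E := {clinear E -> R^o}.

Section ContinuousLinearTheory.
Context (R : realType).

Fact clinear_comp_subproof (U V W : normedModType R)
    (g : {clinear V -> W}) (f : {clinear U -> V}) :
  (g \o f : U -> W) \in @clinear_pred R U W.
Proof.
apply/asboolP; split; first by move=> a x y /=; rewrite !linearP.
by move=> x; apply: continuous_comp; exact: clinear_continuous.
Qed.
Definition clinear_comp (U V W : normedModType R)
    (g : {clinear V -> W}) (f : {clinear U -> V}) : {clinear U -> W} :=
  CLinear (clinear_comp_subproof g f).

Fact bidual_point_subproof (E : normedModType R) (x : E) :
  (fun mu : dual R E => mu x : R^o) \in @clinear_pred R (dual R E) R^o.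
Proof.
pose ev : dual R E -> R^o := fun mu => mu x.
have lev : linear ev by move=> a mu nu.
pose Lev := GRing.isLinear.Build R (dual R E) R^o *:%R ev lev.
pose LLev : {linear dual R E -> R^o} := HB.pack ev Lev.
apply/asboolP; split=> //; apply: (bounded_linear_continuous (f := LLev)).
apply/linear_boundedP; exists `|x|; split=> [|r xr mu]; first exact: num_real.
rewrite /= /ev (le_trans (op_normP mu x))// mulrC.
by apply: ler_wpM2r (ltW xr); exact: op_norm_ge0.
Qed.
Definition bidual_point (E : normedModType R) (x : E) : dual R (dual R E) :=
  CLinear (bidual_point_subproof x).

Definition reflexive_space (E : normedModType R) := bijective (@bidual_point E).

End ContinuousLinearTheory.

Section Smoothness.
Context (R : realType).

(* The derivative as an element of the normed space of continuous linear maps;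
   0 where f is not differentiable. *)
Definition frechet (U V : normedModType R) (f : U -> V) (x : U) :
    {clinear U -> V} :=
  xget 0 [set L : {clinear U -> V} |
          differentiable f x /\ (L : U -> V) = 'd f x].

Lemma frechetE (U V : normedModType R) (f : U -> V) (x : U) :
  differentiable f x -> (frechet f x : U -> V) = 'd f x.
Proof.
move=> df; rewrite /frechet; case: xgetP => [L _ [_ ->]//|].
have dfP : ('d f x : U -> V) \in @clinear_pred R U V.
  apply/asboolP; split; last exact: diff_continuous.
  by move=> a u v; rewrite linearP.
by move=> /(_ (CLinear dfP)) /not_andP[|].
Qed.

(* Only meaningful for D open. *)
Fixpoint C_on (n : nat) (U V : normedModType R) (D : set U) (f : U -> V) : Prop :=
  match n with
  | 0 => forall x, D x -> {for x, continuous f}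
  | n'.+1 => (forall x, D x -> differentiable f x) /\ C_on n' D (frechet f)
  end.

Definition smooth_on (U V : normedModType R) (D : set U) (f : U -> V) :=
  forall n, C_on n D f.

Definition smooth (U V : normedModType R) (f : U -> V) := smooth_on setT f.

Definition diffeo (U V : normedModType R) (A : set U) (B : set V)
    (f : U -> V) (g : V -> U) :=
  [/\ open A, open B, smooth_on A f, smooth_on B g &
      (forall x, A x -> B (f x) /\ g (f x) = x) /\
      (forall y, B y -> A (g y) /\ f (g y) = y)].

(* Straightening charts, so the tangent spaces are closed and complemented. *)
Definition is_submanifold (F : normedModType R) (S : set F) :=
  exists N C : normedModType R, forall z, S z ->
    exists (A : set F) (B : set (N * C)) (f : F -> (N * C)%type)
           (g : (N * C)%type -> F),
      [/\ A z, diffeo A B f g & forall x, A x -> (S x <-> (f x).2 = 0)].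

Definition tangent (F : normedModType R) (S : set F) (z : F) : set F :=
  [set v | exists c : R -> F, [/\ c 0 = z, \forall t \near (0 : R), S (c t) &
                                  is_derive (0 : R) (1 : R) c v]].

End Smoothness.

(* For normed spaces, T^*M is M * dual M and T(T^*M) is trivial, with fibre
   M * dual M. *)
Section MorseFamilies.
Context (R : realType).

(* Sign convention: ((zeta, upsilon), (zeta', upsilon')) is mapped to
   <upsilon, zeta'> - <upsilon', zeta>. *)
Definition canonical_form (M : normedModType R) (v w : M * dual R M) : R :=
  v.2 w.1 - w.2 v.1.

Definition is_lagrangian (M : normedModType R) (S : set (M * dual R M)) :=
  is_submanifold S /\
  forall z, S z -> forall v,
    tangent S z v <-> forall w, tangent S z w -> canonical_form v w = 0.

Context (P M : normedModType R) (pi : P -> M).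

Definition im_d (E : P -> R^o) : set (P * dual R P) :=
  [set (p, frechet E p) | p in setT].

Definition vertical_annihilator : set (P * dual R P) :=
  [set z : P * dual R P | forall v, frechet pi z.1 v = 0 -> z.2 v = 0].

Definition morse_family (E : P -> R^o) :=
  smooth E /\
  forall z, (im_d E `&` vertical_annihilator) z ->
  forall w, exists u v, [/\ tangent (im_d E) z u,
    tangent vertical_annihilator z v & w = u + v].

Definition generated_set (E : P -> R^o) : set (M * dual R M) :=
  [set z : M * dual R M |
   exists p, z.1 = pi p /\ clinear_comp z.2 (frechet pi p) = frechet E p].

Definition generates (E : P -> R^o) (S : set (M * dual R M)) :=
  [/\ morse_family E, is_lagrangian S & S = generated_set E].

End MorseFamilies.

Section LieGroups.
Context (R : realType).

Record chart (T : Type) (E : normedModType R) := Chart {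
  chart_dom : set T;
  chart_fun :> T -> E;
  chart_inv : E -> T }.

Definition is_atlas (T : Type) (E : normedModType R) (A : set (chart T E)) :=
  [/\ forall x, exists2 c, A c & chart_dom c x,
      forall c, A c -> forall x, chart_dom c x -> chart_inv c (c x) = x &
      forall c d, A c -> A d ->
        let D := c @` (chart_dom c `&` chart_dom d) in
        open D /\ smooth_on D (d \o chart_inv c)].

Definition manifold_open (T : Type) (E : normedModType R)
    (A : set (chart T E)) (O : set T) :=
  forall c, A c -> open (c @` (chart_dom c `&` O)).

Definition manifold_hausdorff (T : Type) (E : normedModType R)
    (A : set (chart T E)) :=
  forall x y : T, x <> y -> exists O O' : set T,
    [/\ manifold_open A O, manifold_open A O', O x, O' y & O `&` O' = set0].

Definition prod_chart (S T : Type) (E F : normedModType R)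
    (c : chart S E) (d : chart T F) : chart (S * T) (E * F)%type :=
  {| chart_dom := chart_dom c `*` chart_dom d;
     chart_fun := fun x => (c x.1, d x.2);
     chart_inv := fun y => (chart_inv c y.1, chart_inv d y.2) |}.

Definition prod_atlas (S T : Type) (E F : normedModType R)
    (A : set (chart S E)) (B : set (chart T F)) : set (chart (S * T) (E * F)%type) :=
  [set e | exists c d, [/\ A c, B d & e = prod_chart c d]].

(* The existence of O includes the continuity of f. *)
Definition smooth_map (S T : Type) (E F : normedModType R)
    (A : set (chart S E)) (B : set (chart T F)) (f : S -> T) :=
  forall c d x, A c -> B d -> chart_dom c x -> chart_dom d (f x) ->
  exists O : set E,
    [/\ open O, O (c x), O `<=` c @` chart_dom c,
        forall y, O y -> chart_dom d (f (chart_inv c y)) &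
        smooth_on O (d \o f \o chart_inv c)].

(* The chart lie_chart1 at the identity identifies the Lie algebra T_eG with the
   Banach space E. *)
Record lieGroup (E : completeNormedModType R) := LieGroup {
  lie_group :> groupType;
  lie_atlas : set (chart lie_group E);
  lie_chart1 : chart lie_group E;
  lie_atlasP : is_atlas lie_atlas;
  lie_hausdorff : manifold_hausdorff lie_atlas;
  lie_chart1P : lie_atlas lie_chart1 /\ chart_dom lie_chart1 1%g;
  lie_mul_smooth : smooth_map (prod_atlas lie_atlas lie_atlas) lie_atlas
    (fun x : lie_group * lie_group => (x.1 * x.2)%g);
  lie_inv_smooth : smooth_map lie_atlas lie_atlas
    (fun x : lie_group => x^-1%g) }.

Context (E : completeNormedModType R) (G : lieGroup E).

(* conjg h g is g^-1 * h * g. *)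
Definition Ad (g : G) : {clinear E -> E} :=
  let phi := lie_chart1 G in
  frechet (fun x => phi (conjg (chart_inv phi x) g)) (phi 1%g).

(* With this right adjoint action the bracket is the opposite of the one of
   left invariant vector fields. *)
Definition ad : {clinear E -> {clinear E -> E}} :=
  let phi := lie_chart1 G in
  frechet (fun x => Ad (chart_inv phi x)) (phi 1%g).

Definition Ad_star (g : G) (mu : dual R E) : dual R E :=
  clinear_comp mu (Ad g^-1%g).

Definition ad_star (xi : E) (mu : dual R E) : dual R E :=
  clinear_comp mu (ad xi).

Definition coadjoint_orbit (lambda : dual R E) : set (dual R E) :=
  [set Ad_star g^-1%g lambda | g in setT].

Definition z_d (lambda : dual R E) : set (dual R E * dual R E * E) :=
  coadjoint_orbit lambda `*` setT `*` setT.

(* ad_star xi mu need not lie in the orbit, so z_d is only a part of the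
   codomain. *)
Definition kappa (z : E * dual R E) : dual R E * dual R E * E :=
  (ad_star z.1 z.2, z.2, z.1).

End LieGroups.

Section LiePoisson.
Context (R : realType) (E : completeNormedModType R).

(* For E reflexive, the element of E representing the derivative of h at mu. *)
Definition fderiv (h : dual R E -> R^o) (mu : dual R E) : E :=
  xget 0 [set xi | bidual_point xi = frechet h mu].

Definition E_h_to_l (h : dual R E -> R^o) (z : E * dual R E) : R^o :=
  z.2 z.1 - h z.2.

Definition s_cotangent (h : dual R E -> R^o) : set (E * dual R E) :=
  [set (fderiv h mu, mu) | mu in setT].

Definition lie_poisson_set (G : lieGroup E) (h : dual R E -> R^o) :
    set (dual R E * dual R E * E) :=
  [set (ad_star G (fderiv h mu) mu, mu, fderiv h mu) | mu in setT].

Definition s_z_d (G : lieGroup E) (lambda : dual R E) (h : dual R E -> R^o) :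
    set (dual R E * dual R E * E) :=
  lie_poisson_set G h `&` z_d G lambda.

End LiePoisson.

(* Main.v *)
Require Import Defs.
From HB Require Import structures.
From mathcomp Require Import all_boot all_order all_algebra.
From mathcomp Require Import all_classical all_reals all_analysis.
From mathcomp Require Import ring.
Import numFieldNormedType.Exports.
Local Open Scope classical_set_scope.
Local Open Scope ring_scope.

(** The Morse family [E(xi, mu) = <mu, xi> - h(mu)] has differential
<<
      dE(xi, mu)(a, nu) = nu(xi) + mu(a) - dh(mu)(nu).
>>
Its restriction to vertical vectors [(0, nu)] vanishes exactly when [xi],
seen in the bidual, is [dh(mu)]; the remaining part of [dE] is then [mu].
Hence the generated set is the graph of the Legendre map [phi := J o dh] over
the dual, where [J] inverts the embedding of the Lie algebra in its bidual
([generated_E_h_to_l]).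

Reflexivity provides [J] as a linear bijection, while smoothness of [phi]
requires it to be bounded. Boundedness follows from the Hahn-Banach theorem: every
vector is normed by a functional of norm at most one ([norming_functional]), so
the embedding in the bidual does not decrease norms ([bidual_inverse]).

The graph of a smooth map is a submanifold, straightened by subtracting the map
([graph_submanifold]), and its tangent vectors at [mu] are the
[(phi'(mu) nu, nu)] ([tangent_graph]). On two of them the canonical form is
<<
      d2h(mu)(nu', nu) - d2h(mu)(nu, nu'),
>>
which vanishes by the symmetry of the second derivative ([frechet2_sym]).
Conversely a vector orthogonal to all tangent vectors is tangent because the
embedding in the bidual is injective ([lagrangian_s_cotangent]).

The Morse condition already holds when only [xi] varies: the mixed second
derivative of [E] in the directions [(xi', 0)] and [(0, nu)] is [nu(xi')], and
by reflexivity every continuous linear form in [nu] arises in this way, so the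
vertical part of any covector can be matched by a vector tangent to the image
of [dE] ([morse_family_E_h_to_l]).

The two statements on [kappa] hold by unfolding the definitions. *)

Set Implicit Arguments.
Unset Strict Implicit.
Unset Printing Implicit Defensive.
Import Order.TTheory GRing.Theory Num.Theory.

(** * Continuous linear maps *)

Section Bounded.
Context (R : realType) (U V : normedModType R).

Lemma bounded_clinear (f : U -> V) (M : R) :
  linear f -> (forall x, `|f x| <= M * `|x|) -> f \in @clinear_pred R U V.
Proof.
move=> lf fM; pose Lf := GRing.isLinear.Build R U V *:%R f lf.
pose LLf : {linear U -> V} := HB.pack f Lf.
apply/asboolP; split=> //; apply: (bounded_linear_continuous (f := LLf)).
apply/linear_boundedP; exists M; split=> [|r Mr x]; first exact: num_real.
by rewrite (le_trans (fM x))// ler_wpM2r// ltW.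
Qed.

Lemma clinearDE (f g : {clinear U -> V}) x : (f + g) x = f x + g x.
Proof. by []. Qed.

Lemma clinearZE a (f : {clinear U -> V}) x : (a *: f) x = a *: f x.
Proof. by []. Qed.

End Bounded.

(** * Norming functionals *)

Section HahnBanach.
Context (R : realType) (E : normedModType R).

(** Partial linear functionals bounded by the norm are encoded by their graphs,
    closed under linear combinations. Single-valuedness follows from the bound
    ([dominated_graph_fun]), and unions of chains of functionals are plain
    unions of sets. The empty set satisfies the definition, which takes care of
    the empty chain. *)
Definition dominated_graph (A : set (E * R^o)) :=
  (forall a z w, A z -> A w -> A (a *: z + w)) /\
  (forall z, A z -> z.2 <= `|z.1|).

Lemma dominated_graph_fun A x r s : dominated_graph A ->
  A (x, r) -> A (x, s) -> r = s.
Proof.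
move=> [lin dom]; suff le r' s' : A (x, r') -> A (x, s') -> s' <= r'.
  by move=> Ar As; apply/eqP; rewrite eq_le !le.
move=> Ar As; have := dom _ (lin (-1) _ _ Ar As).
by rewrite /= !scaleN1r addNr normr0 addrC subr_le0.
Qed.

(** The one-dimensional extension step of Hahn-Banach: a value [c] at [y] is
    admissible when [r - |x - y| <= c <= |x' + y| - r'] for all [(x, r)] and
    [(x', r')] in the graph, and the triangle inequality makes every lower bound
    at most every upper bound. *)
Lemma dominated_graph_extend A y : dominated_graph A -> A !=set0 ->
  exists2 B, dominated_graph B & A `<=` B /\ exists c, B (y, c).
Proof.
move=> [lin dom] [z0 Az0].
have A0 : A 0 by have := lin (-1) _ _ Az0 Az0; rewrite scaleN1r addNr.
have scale a z : A z -> A (a *: z).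
  by move=> Az; rewrite -[_ *: _]addr0; exact: lin.
(* The admissible value at y is the supremum of these lower bounds. *)
pose lower := [set z.2 - `|z.1 - y| | z in A].
have lowerP z w : A z -> A w -> z.2 - `|z.1 - y| <= `|w.1 + y| - w.2.
  move=> Az Aw; rewrite lerBrDr addrAC lerBlDr.
  have /= := dom _ (lin 1 _ _ Az Aw); rewrite !scale1r => /le_trans; apply.
  rewrite (_ : z.1 + w.1 = (w.1 + y) + (z.1 - y)) ?ler_normD//.
  by rewrite addrACA subrr addr0 addrC.
have lower_sup : has_sup lower.
  split; first by exists (z0.2 - `|z0.1 - y|), z0.
  by exists (`|z0.1 + y| - z0.2) => _ [z Az <-]; exact: lowerP.
pose c : R^o := sup lower.
have lec z : A z -> z.2 - c <= `|z.1 - y|.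
  move=> Az; rewrite lerBlDr addrC -lerBlDr; apply: sup_upper_bound => //.
  by exists z.
have gec w : A w -> w.2 + c <= `|w.1 + y|.
  move=> Aw; rewrite addrC -lerBrDr; apply: ge_sup; first by case: lower_sup.
  by move=> _ [z Az <-]; exact: lowerP.
exists [set z + t *: (y, c) | z in A & t in setT].
  split=> [a _ _ [z Az [t _ <-]] [w Aw [u _ <-]]|_ [z Az [t _ <-]]] /=.
    exists (a *: z + w); first exact: lin.
    by exists (a * t + u) => //; rewrite scalerDr scalerDl scalerA addrACA.
  have [t0|t0|->] := ltgtP t 0; last by rewrite !scale0r !addr0; exact: dom.
  - have := lec _ (scale (- t)^-1 _ Az).
    rewrite /= -(ler_pM2l (_ : 0 < - t)) ?oppr_gt0//.
    rewrite -[X in _ <= X * _]gtr0_norm ?oppr_gt0// -normrZ scalerBr mulrBr.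
    rewrite [_ *: (_ *: _)]scalerA mulrA mulfV ?oppr_eq0 ?lt_eqF//.
    by rewrite scale1r mul1r mulNr scaleNr !opprK.
  - have := gec _ (scale t^-1 _ Az).
    rewrite /= -(ler_pM2l (_ : 0 < t))//.
    rewrite -[X in _ <= X * _]gtr0_norm// -normrZ scalerDr mulrDr.
    by rewrite [_ *: (_ *: _)]scalerA mulrA mulfV ?gt_eqF// scale1r mul1r.
split=> [z Az|]; first by exists z => //; exists 0 => //; rewrite scale0r addr0.
by exists c, 0 => //; exists 1 => //; rewrite scale1r add0r.
Qed.

(** A graph that is maximal, by Zorn's lemma, among the dominated ones that
    contain [(x0, |x0|)] as soon as they are nonempty is the graph of an
    everywhere defined functional. *)
Lemma norming_functional (x0 : E) :
  exists2 mu : dual R E, (forall x, `|mu x| <= `|x|) & mu x0 = `|x0|.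
Proof.
pose line : set (E * R^o) := [set a *: (x0, `|x0|) | a in setT].
have line_dom : dominated_graph line.
  split=> [a _ _ [t _ <-] [u _ <-]|_ [t _ <-]] /=.
    by exists (a * t + u) => //; rewrite scalerDl scalerA.
  by rewrite normrZ ler_wpM2r// ler_norm.
pose P A := dominated_graph A /\ (A !=set0 -> A (x0, `|x0|)).
have [F FP Ftot|A [[domA A0] maxA]] := @Zorn_bigcup _ P.
  split; last first.
    by move=> [z [X FX Xz]]; exists X => //; apply: (FP _ FX).2; exists z.
  split=> [a z w [X FX Xz] [Y FY Yw]|z [X FX Xz]]; last exact: (FP _ FX).1.2.
  have [XY|YX] := Ftot _ _ FX FY.
    by exists Y => //; apply: (FP _ FY).1.1 => //; exact: XY.
  by exists X => //; apply: (FP _ FX).1.1 => //; exact: YX.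
have lineP : line (x0, `|x0|) by exists 1 => //; rewrite scale1r.
have neA : A !=set0.
  apply: contrapT => eA; apply: (maxA line).
    split=> [z Az|lA]; [exfalso|]; apply: eA; first by exists z.
    by exists (x0, `|x0|); exact: lA.
  by split=> // _.
have totA x : exists r, A (x, r).
  have [B domB [AB [c Bc]]] := dominated_graph_extend x domA neA.
  exists c; apply: contrapT => nAc; apply: (maxA B).
    by split=> // BA; apply: nAc; exact: BA.
  by split=> // _; apply: AB; exact: A0.
have [f fP] := choice totA.
have lin_f : linear (f : E -> R^o).
  move=> a x y; apply: (dominated_graph_fun domA (fP _)).
  exact: (domA.1 a _ _ (fP x) (fP y)).
have f_le x : `|f x| <= `|x|.
  have f_ub := domA.2 _ (fP x); rewrite ler_norml f_ub andbT.
  have := domA.1 (-1) _ _ (fP x) (fP x); rewrite scaleN1r addNr => Az.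
  have /domA.2 /= := domA.1 (-1) _ _ (fP x) Az.
  by rewrite !addr0 !scaleN1r normrN lerNl.
have fC : (f : E -> R^o) \in @clinear_pred R E R^o.
  by apply: (bounded_clinear (M := 1)) => // x; rewrite mul1r.
exists (CLinear fC) => //=.
exact: (dominated_graph_fun domA (fP _) (A0 neA)).
Qed.

End HahnBanach.

Section Bidual.
Context (R : realType) (E : normedModType R).

Lemma norm_le_bidual (x : E) : `|x| <= `|bidual_point x|.
Proof.
have [mu mu_le mux] := norming_functional x.
have -> : `|x| = `|bidual_point x mu| by rewrite /= mux normr_id.
apply: op_norm_ub; apply: op_norm_le => y y1.
by rewrite (le_trans (mu_le y)).
Qed.

Lemma bidual_point_linear : linear (@bidual_point R E).
Proof. by move=> a x y; apply: clinearP => mu /=; rewrite linearP. Qed.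

(** The inverse is bounded by 1 since the embedding does not decrease norms
    ([norm_le_bidual]). *)
Lemma bidual_inverse : reflexive_space E ->
  exists2 J : {clinear dual R (dual R E) -> E},
    cancel J (@bidual_point R E) & cancel (@bidual_point R E) J.
Proof.
move=> [j jK Kj].
have lin_j : linear j.
  move=> a F H; apply: (can_inj jK).
  by rewrite bidual_point_linear !Kj.
have jC : j \in @clinear_pred R (dual R (dual R E)) E.
  apply: (bounded_clinear (M := 1)) => // F.
  by rewrite mul1r -{2}(Kj F); exact: norm_le_bidual.
by exists (CLinear jC).
Qed.

End Bidual.

(** * Calculus of Frechet derivatives *)

Section FrechetCalculus.
Context (R : realType).
Implicit Types U V W : normedModType R.

Lemma is_diff_clinear U V (L : {clinear U -> V}) x : is_diff x L L.
Proof.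
apply: DiffDef; first exact/linear_differentiable/clinear_continuous.
exact/diff_lin/clinear_continuous.
Qed.

Lemma frechet_eq U V (f : U -> V) x (L : {clinear U -> V}) :
  is_diff x f L -> frechet f x = L.
Proof.
by move=> fL; apply: clinearP => v; rewrite frechetE// diff_val.
Qed.

Lemma frechet_is_diff U V (f : U -> V) x :
  differentiable f x -> is_diff x f (frechet f x).
Proof. by move=> df; apply: DiffDef => //; rewrite frechetE. Qed.

Lemma frechet_clinear U V (L : {clinear U -> V}) : frechet L = cst L.
Proof. by apply/funext => x; apply: frechet_eq; exact: is_diff_clinear. Qed.

Lemma C_on_cst n U V (c : V) : C_on n setT (cst c : U -> V).
Proof.
elim: n U V c => [|n IH] U V c; first by move=> x _; exact: cst_continuous.
split=> [x _|]; first exact: differentiable_cst.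
rewrite (_ : frechet _ = cst 0); first exact: IH.
by apply/funext => x; apply: frechet_eq; exact: is_diff_cst.
Qed.

Lemma C_on_clinear n U V (L : {clinear U -> V}) : C_on n setT L.
Proof.
case: n => [|n]; first by move=> x _; exact: clinear_continuous.
split=> [x _|]; first by have := is_diff_clinear L x.
by rewrite frechet_clinear; exact: C_on_cst.
Qed.

Lemma C_onD n U V (f g : U -> V) :
  C_on n setT f -> C_on n setT g -> C_on n setT (f + g).
Proof.
elim: n U V f g => [|n IH] U V f g; first
  by move=> cf cg x _; exact: cvgD (cf _ _) (cg _ _).
move=> [df cf] [dg cg]; split=> [x _|].
  by apply: differentiableD; [exact: df|exact: dg].
rewrite (_ : frechet _ = frechet f + frechet g); first exact: IH.
apply/funext => x; apply: frechet_eq.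
have dfx := frechet_is_diff (df x I); have dgx := frechet_is_diff (dg x I).
exact: is_diffD.
Qed.

Fact clinear_comp2_subproof U' U V V' (A : {clinear V -> V'})
    (B : {clinear U' -> U}) :
  (fun L : {clinear U -> V} => clinear_comp A (clinear_comp L B)) \in
    @clinear_pred R {clinear U -> V} {clinear U' -> V'}.
Proof.
apply: (bounded_clinear (M := op_norm A * op_norm B)) => [a L K|L].
  by apply: clinearP => x /=; rewrite linearP.
apply: op_norm_le => x x1 /=.
rewrite (le_trans (op_normP _ _))// -mulrA ler_wpM2l ?op_norm_ge0//.
rewrite (le_trans (op_normP _ _))// mulrC ler_wpM2r ?op_norm_ge0//.
by rewrite (le_trans (op_normP _ _))// ler_piMr// op_norm_ge0.
Qed.
Definition clinear_comp2 U' U V V' (A : {clinear V -> V'})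
    (B : {clinear U' -> U}) := CLinear (clinear_comp2_subproof A B).

Lemma is_diff_comp_clinear U' U V V' (A : {clinear V -> V'})
    (B : {clinear U' -> U}) (f : U -> V) x : differentiable f (B x) ->
  is_diff x (A \o f \o B) (clinear_comp2 A B (frechet f (B x))).
Proof.
move=> df; have dB := is_diff_clinear B x; have dA := is_diff_clinear A (f (B x)).
by have dfBx := frechet_is_diff df; exact: is_diff_comp.
Qed.

(** The derivative of [A o f o B] is [Phi o frechet f o B], where [Phi] is the
    continuous linear map [clinear_comp2 A B] between spaces of linear maps. It has
    the same form as the map itself, so the induction on the order closes
    without a chain rule for general composites. *)
Lemma C_on_comp_clinear n U' U V V' (A : {clinear V -> V'})
    (B : {clinear U' -> U}) (f : U -> V) :
  C_on n setT f -> C_on n setT (A \o f \o B).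
Proof.
elim: n U' U V V' A B f => [|n IH] U' U V V' A B f.
  move=> cf x _; apply: continuous_comp; first exact: clinear_continuous.
  by apply: continuous_comp; [exact: cf|exact: clinear_continuous].
move=> [df cf]; have dfx x := is_diff_comp_clinear A (df (B x) I).
split=> [x _|]; first by have := dfx x.
rewrite (_ : frechet _ = clinear_comp2 A B \o frechet f \o B); first exact: IH.
by apply/funext => x; exact: frechet_eq.
Qed.

Fact clinear_id_subproof U : id \in @clinear_pred R U U.
Proof. by apply: (bounded_clinear (M := 1)) => // x; rewrite mul1r. Qed.
Definition clinear_id U := CLinear (clinear_id_subproof U).

End FrechetCalculus.

(** * Products and the duality pairing *)

Section Products.
Context (R : realType).
Implicit Types U V : normedModType R.

Fact clinear_fst_subproof U V : fst \in @clinear_pred R (U * V)%type U.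
Proof.
by apply: (bounded_clinear (M := 1)) => // x;
  rewrite mul1r prod_normE le_max lexx.
Qed.
Definition clinear_fst U V := CLinear (clinear_fst_subproof U V).

Fact clinear_snd_subproof U V : snd \in @clinear_pred R (U * V)%type V.
Proof.
by apply: (bounded_clinear (M := 1)) => // x;
  rewrite mul1r prod_normE le_max lexx orbT.
Qed.
Definition clinear_snd U V := CLinear (clinear_snd_subproof U V).

Fact clinear_inl_subproof U V : (fun u => (u, 0)) \in @clinear_pred R U (U * V)%type.
Proof.
apply: (bounded_clinear (M := 1)) => [a x y|x].
  by congr (_, _); rewrite /= scaler0 addr0.
by rewrite mul1r prod_normE /= normr0 ge_max lexx normr_ge0.
Qed.
Definition clinear_inl U V := CLinear (clinear_inl_subproof U V).

Fact clinear_inr_subproof U V : (fun v => (0, v)) \in @clinear_pred R V (U * V)%type.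
Proof.
apply: (bounded_clinear (M := 1)) => [a x y|x].
  by congr (_, _); rewrite /= scaler0 addr0.
by rewrite mul1r prod_normE /= normr0 ge_max lexx normr_ge0.
Qed.
Definition clinear_inr U V := CLinear (clinear_inr_subproof U V).

(** A remainder bounded by a multiple of the squared norm is negligible. *)
Lemma is_diff_quadratic U V (f : U -> V) (L : {clinear U -> V}) x (M : R) :
  (forall v, `|f (v + x) - (f x + L v)| <= M * `|v| ^+ 2) -> is_diff x f L.
Proof.
move=> fM.
have fL : f \o shift x = cst (f x) + L +o_ 0 id.
  have M_le : M <= `|M| + 1 by rewrite (le_trans (ler_norm M))// lerDl.
  have M1 : 0 < `|M| + 1 by rewrite ltr_pwDr.
  apply/eqaddoP => _/posnumP[e]; near=> v.
  apply: le_trans (fM v) _; rewrite expr2 mulrA ler_wpM2r//.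
  apply: le_trans (ler_wpM2r (normr_ge0 v) M_le) _.
  rewrite mulrC -ler_pdivlMr; last exact: M1.
  near: v; apply: cvgr0_norm_le; last by rewrite divr_gt0.
  exact: cvg_id.
have dE : 'd f x = L :> (U -> V).
  by apply: diff_unique => //; exact: clinear_continuous.
apply: DiffDef => //; apply/diff_locallyP; rewrite dE.
by split => //; exact: clinear_continuous.
Unshelve. all: by end_near. Qed.

End Products.

Section Pairing.
Context (R : realType) (E : normedModType R).

Definition pairing (z : E * dual R E) : R^o := z.2 z.1.

Let pairing_diff0 (z w : E * dual R E) : R^o := w.2 z.1 + z.2 w.1.

Let pairing_diff0_le z w : `|pairing_diff0 z w| <= 2 * `|z| * `|w|.
Proof.
have bound (a b : E * dual R E) : `|a.2 b.1| <= `|a| * `|b|.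
  apply: le_trans (op_normP _ _) _.
  apply: ler_pM; rewrite ?op_norm_ge0//; last by rewrite prod_normE le_max lexx.
  by rewrite prod_normE le_max lexx orbT.
rewrite (le_trans (ler_normD _ _))// -mulrA mulrDl mul1r lerD//.
by rewrite mulrC bound.
Qed.

Fact pairing_diff_subproof z : pairing_diff0 z \in
  @clinear_pred R (E * dual R E)%type R^o.
Proof.
apply: bounded_clinear (pairing_diff0_le z) => a x y.
rewrite /pairing_diff0 /= [X in X + _](_ : _ = a *: x.2 z.1 + y.2 z.1)//.
by rewrite linearP scalerDr addrACA.
Qed.

Fact pairing_diff_subproof2 : (fun z => CLinear (pairing_diff_subproof z)) \in
  @clinear_pred R (E * dual R E)%type {clinear (E * dual R E)%type -> R^o}.
Proof.
apply: (bounded_clinear (M := 2)) => [a x y|z].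
  apply: clinearP => w; rewrite clinearDE clinearZE /= /pairing_diff0 /=.
  rewrite [X in _ + X](_ : _ = a *: x.2 w.1 + y.2 w.1)//.
  by rewrite linearP scalerDr addrACA.
apply: op_norm_le => w w1; rewrite (le_trans (pairing_diff0_le z w))//.
by rewrite ler_piMr// mulr_ge0.
Qed.
Definition pairing_diff := CLinear pairing_diff_subproof2.

Lemma pairing_diffE z w : pairing_diff z w = w.2 z.1 + z.2 w.1.
Proof. by []. Qed.

Lemma is_diff_pairing z : is_diff z pairing (pairing_diff z).
Proof.
apply: (is_diff_quadratic (M := 1)) => v; rewrite mul1r pairing_diffE /pairing /=.
rewrite [X in `|X|](_ : _ = v.2 v.1); last first.
  rewrite [X in X - _](_ : _ = v.2 (v.1 + z.1) + z.2 (v.1 + z.1))//.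
  by rewrite ![_ (v.1 + z.1)]linearD /=; ring.
apply: le_trans (op_normP _ _) _; rewrite expr2.
by apply: ler_pM; rewrite ?op_norm_ge0// prod_normE le_max lexx ?orbT.
Qed.

(** The derivative of the pairing is itself a continuous linear map of the base
    point, and such maps are smooth. *)
Lemma smooth_pairing : smooth pairing.
Proof.
case=> [|n].
  by move=> z _; apply: differentiable_continuous; have := is_diff_pairing z.
split=> [z _|]; first by have := is_diff_pairing z.
rewrite (_ : frechet _ = pairing_diff); first exact: C_on_clinear.
by apply/funext => z; exact/frechet_eq/is_diff_pairing.
Qed.

End Pairing.

(** * Symmetry of the second derivative *)

Section Lines.
Context (R : realType).
Implicit Types U V : normedModType R.

Lemma is_diff_is_derive U V (f : U -> V) df x (v : U) :
  is_diff x f df -> is_derive x v f (df v).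
Proof.
move=> fdf; apply: DeriveDef; first exact: diff_derivable.
by rewrite deriveE// diff_val.
Qed.

Arguments is_diff_is_derive {U V f df x} v.

Lemma is_derive_line U V (f : U -> V) x u (t : R) :
  differentiable f (x + t *: u) ->
  is_derive t (1 : R) (fun s : R => f (x + s *: u)) (frechet f (x + t *: u) u).
Proof.
move=> df; have dfx := frechet_is_diff df.
have dl : is_diff t (cst x + ( *:%R ^~ u) : R -> U) (0 + ( *:%R ^~ u)).
  exact: is_diffD.
have := @is_diff_comp _ _ _ _ _ _ _ _ _ dl dfx.
move=> /(is_diff_is_derive (1 : R)).
by rewrite /= add0r scale1r.
Qed.

Lemma mean_value (g dg : R -> R) (t : R) : 0 < t ->
  (forall s : R, is_derive s (1 : R) g (dg s)) ->
  exists2 s, 0 < s < t & g t - g 0 = dg s * t.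
Proof.
move=> t0 dgP.
have cg : {within `[0, t], continuous g}.
  apply: derivable_within_continuous => s _.
  exact: (@ex_derive _ _ _ _ _ _ _ (dgP s)).
have [s st gE] := @MVT R g dg 0 t t0 (fun s _ => dgP s) cg.
by exists s; [move: st; rewrite in_itv|rewrite gE subr0].
Qed.

Fact clinear_eval_subproof U V (v : U) :
  (fun L : {clinear U -> V} => L v) \in @clinear_pred R {clinear U -> V} V.
Proof.
apply: (bounded_clinear (M := `|v|)) => // L.
by rewrite mulrC; exact: op_normP.
Qed.
Definition clinear_eval U V v := CLinear (@clinear_eval_subproof U V v).

End Lines.

Section Schwarz.
Context (R : realType) (U : normedModType R) (f : U -> R^o).
Hypothesis df : forall x, differentiable f x.
Hypothesis ddf : forall x, differentiable (frechet f) x.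

(** The mean value theorem is applied to [s |-> f (p + s u + t v) - f (p + s u)],
    then to the derivative of [f] on [u] as a function of the [v] coordinate. *)
Lemma second_difference p u v (t : R) : 0 < t ->
  exists s r, [/\ 0 < s < t, 0 < r < t &
    f (p + t *: u + t *: v) - f (p + t *: u) - f (p + t *: v) + f p =
    frechet (frechet f) (p + s *: u + r *: v) v u * t * t].
Proof.
move=> t0.
pose k := fun s : R => f ((p + t *: v) + s *: u) - f (p + s *: u).
have [s st kE] := @mean_value R k
  (fun s => frechet f ((p + t *: v) + s *: u) u - frechet f (p + s *: u) u) t t0
  (fun s => is_deriveB (is_derive_line (df _)) (is_derive_line (df _))).
have dm r : is_derive r (1 : R) (fun r : R => frechet f (p + s *: u + r *: v) u)
    (frechet (frechet f) (p + s *: u + r *: v) v u).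
  have dfu : is_diff (p + s *: u + r *: v) (clinear_eval R^o u \o frechet f)
      (clinear_comp (clinear_eval R^o u)
        (frechet (frechet f) (p + s *: u + r *: v))).
    have d1 := frechet_is_diff (ddf (p + s *: u + r *: v)).
    have d2 := is_diff_clinear (clinear_eval R^o u)
      (frechet f (p + s *: u + r *: v)).
    exact: is_diff_comp.
  have := @is_derive_line R U R^o _ (p + s *: u) v r (@ex_diff _ _ _ _ _ _ _ dfu).
  by rewrite (frechet_eq dfu).
have [r rt mE] := mean_value t0 dm.
exists s, r; split=> //.
rewrite -mE /= scale0r addr0 [p + s *: u + _]addrAC -kE /k !scale0r !addr0.
by rewrite [p + t *: v + _]addrAC opprB addrA [RHS]addrAC.
Qed.

Lemma frechet2_continuous_eval p u v : {for p, continuous (frechet (frechet f))} ->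
  {for p, continuous (fun q => frechet (frechet f) q u v : R)}.
Proof.
move=> cddf; apply: (@continuous_comp _ _ _ _
  (fun L : {clinear U -> {clinear U -> R^o}} => L u v)) => //.
apply: (@continuous_comp _ _ _ (clinear_eval _ u) (clinear_eval R^o v)).
  exact: clinear_continuous.
exact: clinear_continuous.
Qed.

(** The second difference is symmetric in [u] and [v]. Computed in both orders it
    yields points [q], [q'] arbitrarily close to [p] such that the second
    derivative at [q] on [(v, u)] equals the one at [q'] on [(u, v)]; continuity
    at [p] gives the result. *)
Theorem frechet2_sym p u v : {for p, continuous (frechet (frechet f))} ->
  frechet (frechet f) p u v = frechet (frechet f) p v u.
Proof.
move=> cddf; apply/eqP; rewrite -subr_eq0 -normr_le0.
apply/ler_addgt0Pr => e e0; rewrite add0r.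
have e20 : 0 < e / 2 by rewrite divr_gt0.
have near_eval a b : \forall q \near p,
    `|frechet (frechet f) p a b - frechet (frechet f) q a b| <= e / 2.
  have := frechet2_continuous_eval (u := a) (v := b) cddf.
  by move=> /cvgrPdist_le/(_ _ e20).
have /nbhs_ballP[d /= d0 dP] : nbhs p [set q |
    `|frechet (frechet f) p u v - frechet (frechet f) q u v| <= e / 2 /\
    `|frechet (frechet f) p v u - frechet (frechet f) q v u| <= e / 2].
  by apply: filterI; exact: near_eval.
have n1 : 0 < `|u| + `|v| + 1 by rewrite ltr_pwDr// addr_ge0.
(* This step keeps all intermediate points in the ball of radius d. *)
pose t := d / (`|u| + `|v| + 1).
have t0 : 0 < t by rewrite divr_gt0.
have close s r a b : 0 < s < t -> 0 < r < t -> `|a| + `|b| = `|u| + `|v| ->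
    ball p d (p + s *: a + r *: b).
  move=> /andP[s0 st] /andP[r0 rt] ab.
  rewrite -ball_normE /= -addrA opprD addrA subrr sub0r normrN.
  apply: le_lt_trans (ler_normD _ _) _; rewrite !normrZ !gtr0_norm//.
  apply: (@le_lt_trans _ _ (t * (`|a| + `|b|))).
    by rewrite mulrDr lerD// ler_wpM2r// ltW.
  by rewrite ab /t mulrAC ltr_pdivrMr// ltr_pM2l// ltrDl.
have [s [r [st rt Evu]]] := second_difference p u v t0.
have [s' [r' [st' rt' Euv]]] := second_difference p v u t0.
have E : frechet (frechet f) (p + s *: u + r *: v) v u =
         frechet (frechet f) (p + s' *: v + r' *: u) u v.
  apply: (mulIf (lt0r_neq0 t0)); apply: (mulIf (lt0r_neq0 t0)).
  rewrite -Evu -Euv [p + t *: v + _]addrAC; congr (_ + _).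
  by rewrite [LHS]addrAC.
have [_ /= Bvu] := dP _ (close _ _ u v st rt erefl).
have [/= Buv _] := dP _ (close _ _ v u st' rt' (addrC _ _)).
rewrite E in Bvu; rewrite (splitr e).
rewrite -(subrKA (frechet (frechet f) (p + s' *: v + r' *: u) u v)).
rewrite (le_trans (ler_normD _ _))// lerD//.
by rewrite distrC.
Qed.

End Schwarz.

(** * Tangent vectors and graphs *)

Section Tangents.
Context (R : realType).
Implicit Types U V F : normedModType R.

Lemma tangent_range U F (psi dpsi : U -> F) x u : is_diff x psi dpsi ->
  tangent (range psi) (psi x) (dpsi u).
Proof.
move=> psiP; exists (fun t => psi (x + t *: u)); split.
- by rewrite scale0r addr0.
- by near=> t; exists (x + t *: u).
- have := @is_derive_line R U F psi x u 0.
  rewrite scale0r addr0 frechetE ?diff_val; [exact|exact: ex_diff].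
Unshelve. all: by end_near. Qed.

Lemma tangent_subspace F (S : set F) x v :
  (forall a y z, S y -> S z -> S (y + a *: z)) -> S x -> S v -> tangent S x v.
Proof.
move=> linS Sx Sv; exists (fun t => x + t *: v); split.
- by rewrite scale0r addr0.
- by near=> t; exact: linS.
- have := @is_derive_line R F F (clinear_id F) x v 0.
  rewrite frechet_clinear; apply.
  by have := is_diff_clinear (clinear_id F) (x + 0 *: v).
Unshelve. all: by end_near. Qed.

(** A curve in the graph satisfies [c.1 = phi o c.2] near 0; differentiating this
    identity gives the equation of the tangent space. Conversely [(phi'(y) v, v)]
    is the velocity of the image of a straight line. *)
Lemma tangent_graph U V (phi : V -> U) y w : differentiable phi y ->
  tangent [set (phi y, y) | y in setT] (phi y, y) w <-> w.1 = frechet phi y w.2.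
Proof.
move=> dphi; split=> [[c [c0 cS dc]]|].
  have dcd : is_diff (0 : R) c ('d c (0 : R)).
    by apply: differentiableP; apply/derivable1_diffP; exact: ex_derive.
  have dc1 : 'd c (0 : R) 1 = w.
    by rewrite -deriveE ?derive_val//; exact: (@ex_diff _ _ _ _ _ _ _ dcd).
  have dfst : is_derive (0 : R) (1 : R) (fst \o c) w.1.
    have d1 := is_diff_clinear (clinear_fst U V) (c 0).
    have := is_diff_is_derive (1 : R) (is_diff_comp dcd d1).
    by rewrite /= dc1.
  have dsnd : is_derive (0 : R) (1 : R) (phi \o snd \o c) (frechet phi y w.2).
    have d1 := is_diff_clinear (clinear_snd U V) (c 0).
    have d2 : is_diff ((snd \o c) 0) phi (frechet phi y).
      by rewrite /= c0; exact: frechet_is_diff.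
    have := is_diff_is_derive (1 : R) (is_diff_comp (is_diff_comp dcd d1) d2).
    by rewrite /= dc1.
  have eq_c : \forall t \near (0 : R), (fst \o c) t = (phi \o snd \o c) t.
    near=> t; have [z _ cE] : [set (phi y, y) | y in setT] (c t) by near: t.
    by rewrite /= -cE.
  have dfst' := near_eq_is_derive eq_c dfst.
  by rewrite -(@derive_val _ _ _ _ _ _ _ dsnd) (@derive_val _ _ _ _ _ _ _ dfst').
case: w => _ v /= ->.
have dpair : is_diff y (fun y => (phi y, y)) (fun v => (frechet phi y v, v)).
  by have d1 := frechet_is_diff dphi; exact: is_diff_pair.
exact: tangent_range dpair.
Unshelve. all: by end_near. Qed.

Fact clinear_swap_subproof U V :
  (fun z => (z.2, z.1)) \in @clinear_pred R (U * V)%type (V * U)%type.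
Proof.
apply: (bounded_clinear (M := 1)) => // x.
by rewrite mul1r !prod_normE /= maxC.
Qed.
Definition clinear_swap U V := CLinear (clinear_swap_subproof U V).

(** The chart [(x, y) |-> (y, x - phi y)] straightens the graph globally. *)
Lemma graph_submanifold U V (phi : V -> U) : smooth phi ->
  is_submanifold [set (phi y, y) | y in setT].
Proof.
move=> phi_smooth; exists V, U => _ [y _ <-].
exists setT, setT, (fun z => (z.2, z.1 - phi z.2)), (fun z => (z.2 + phi z.1, z.1)).
split=> //; first split=> //; first exact: openT.
- exact: openT.
- rewrite (_ : (fun z => _) = (clinear_swap U V : _ -> _) +
    ((- clinear_inr V U : {clinear _ -> _}) \o phi \o clinear_snd U V)).
    by move=> n; apply: C_onD; [exact: C_on_clinear|exact: C_on_comp_clinear].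
  by apply/funext => -[a b] /=; congr (_, _); rewrite /= oppr0 addr0.
- rewrite (_ : (fun z => _) = (clinear_swap V U : _ -> _) +
    (clinear_inl U V \o phi \o clinear_fst V U)).
    by move=> n; apply: C_onD; [exact: C_on_clinear|exact: C_on_comp_clinear].
  by apply/funext => -[a b] /=; congr (_, _); rewrite /= addr0.
- by split=> -[a b] _ /=; rewrite ?subrK ?addrK.
move=> [a b] _ /=; split=> [[c _ [<- <-]]|/eqP]; first by rewrite subrr.
by rewrite subr_eq0 => /eqP ->; exists b.
Qed.

End Tangents.

(** * The Morse family of a Hamiltonian *)

Section LegendreMorseFamily.
Context (R : realType) (E : completeNormedModType R).
Variables (h : dual R E -> R^o) (h_smooth : smooth h).
Variable J : {clinear dual R (dual R E) -> E}.
Hypothesis J_bidual : cancel J (@bidual_point R E).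
Hypothesis bidual_J : cancel (@bidual_point R E) J.

Let differentiable_h mu : differentiable h mu.
Proof. exact: (h_smooth 1).1. Qed.

Let differentiable_dh mu : differentiable (frechet h) mu.
Proof. exact: (h_smooth 2).2.1. Qed.

Let legendre : dual R E -> E := J \o frechet h.

(** A form to which the results on composites with linear maps on both sides
    apply. *)
Let legendre_comp : legendre = J \o frechet h \o clinear_id (dual R E).
Proof. by []. Qed.

Lemma smooth_legendre : smooth legendre.
Proof.
move=> n; rewrite legendre_comp; apply: C_on_comp_clinear; exact: (h_smooth n.+1).2.
Qed.

Let differentiable_legendre mu : differentiable legendre mu.
Proof. exact: (smooth_legendre 1).1. Qed.

Lemma frechet_legendre mu nu : frechet legendre mu nu = J (frechet (frechet h) mu nu).
Proof.
have dh2 := differentiable_dh (clinear_id _ mu).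
by rewrite legendre_comp (frechet_eq (is_diff_comp_clinear J dh2)).
Qed.

Lemma fderivE mu : fderiv h mu = legendre mu.
Proof.
rewrite /fderiv; case: xgetP => [xi _ /= xiE|/(_ (J (frechet h mu))) []].
  by rewrite /legendre /= -xiE bidual_J.
exact: J_bidual.
Qed.

Lemma s_cotangentE : s_cotangent h = [set (legendre mu, mu) | mu in setT].
Proof. by apply: eq_imagel => mu _; rewrite fderivE. Qed.

(** On the tangent vectors defined by [nu] and [nu'] the canonical form is the
    difference of the values of the second derivative of [h] on [(nu', nu)] and
    on [(nu, nu')]. *)
Lemma lagrangian_s_cotangent : is_lagrangian (s_cotangent h).
Proof.
rewrite s_cotangentE; split; first exact/graph_submanifold/smooth_legendre.
move=> _ [mu _ <-] v.
have formE w : w.1 = frechet legendre mu w.2 ->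
    canonical_form v w = v.2 (frechet legendre mu w.2) - w.2 v.1.
  by rewrite /canonical_form => ->.
have legendreE (nu nu' : dual R E) :
    nu' (frechet legendre mu nu) = frechet (frechet h) mu nu nu'.
  by rewrite frechet_legendre -[LHS]/(bidual_point (J _) nu') J_bidual.
have sym (nu nu' : dual R E) :
    frechet (frechet h) mu nu nu' = frechet (frechet h) mu nu' nu.
  by apply: (frechet2_sym differentiable_h differentiable_dh);
    exact: (h_smooth 2).2.2.
have tangentE w : tangent [set (legendre mu, mu) | mu in setT] (legendre mu, mu) w <->
  w.1 = frechet legendre mu w.2
  by exact/tangent_graph/differentiable_legendre.
split=> [/tangentE vT w /tangentE wT|form0].
  by rewrite formE// vT !legendreE sym subrr.
apply/tangentE/(can_inj bidual_J)/clinearP => nu.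
have := form0 (frechet legendre mu nu, nu); rewrite formE//= legendreE sym.
move=> /(_ _)/subr0_eq Enu; rewrite /= legendreE Enu //.
by apply/tangentE.
Qed.

Lemma frechet_E_h_to_l : frechet (E_h_to_l h) =
  (pairing_diff E : _ -> _) +
  (clinear_comp2 (- clinear_id R^o) (clinear_snd E (dual R E)) \o frechet h \o
    clinear_snd E (dual R E)).
Proof.
apply/funext => z; apply: frechet_eq.
have d1 := is_diff_pairing z.
have d2 := is_diff_comp_clinear (- clinear_id R^o) (differentiable_h (clinear_snd E _ z)).
exact: is_diffD.
Qed.

Lemma smooth_E_h_to_l : smooth (E_h_to_l h).
Proof.
move=> n; apply: (@C_onD R n _ R^o (@pairing R E)
  ((- clinear_id R^o : {clinear _ -> _}) \o h \o clinear_snd E (dual R E))).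
  exact: smooth_pairing.
exact/C_on_comp_clinear/h_smooth.
Qed.

Lemma frechet_fst : frechet (@fst E (dual R E)) = cst (clinear_fst E (dual R E)).
Proof. exact: frechet_clinear (clinear_fst _ _). Qed.

Lemma frechet_E_h_to_lE z w :
  frechet (E_h_to_l h) z w = w.2 z.1 + z.2 w.1 - frechet h z.2 w.2.
Proof. by rewrite frechet_E_h_to_l. Qed.

Lemma frechet2_E_h_to_lE p u w : frechet (frechet (E_h_to_l h)) p u w =
  w.2 u.1 + u.2 w.1 - frechet (frechet h) p.2 u.2 w.2.
Proof.
rewrite frechet_E_h_to_l.
have d1 := is_diff_clinear (pairing_diff E) p.
have d2 := is_diff_comp_clinear (clinear_comp2 (- clinear_id R^o)
  (clinear_snd E (dual R E))) (differentiable_dh (clinear_snd E _ p)).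
by rewrite (frechet_eq (L := pairing_diff E + _) (is_diffD d1 d2)).
Qed.

(** In this form the annihilator is visibly closed under linear combinations, as
    [tangent_subspace] requires. *)
Lemma vertical_annihilator_fst : vertical_annihilator (@fst E (dual R E)) =
  [set z : (E * dual R E) * dual R (E * dual R E)%type |
   forall nu, z.2 (0, nu) = 0].
Proof.
apply/seteqP; split=> z zV; first by move=> nu; apply: zV; rewrite frechet_fst.
by move=> [x nu]; rewrite frechet_fst /= => ->; exact: zV.
Qed.

(** Given a vector [(a, beta)], the tangent vector to the image of the differential
    is chosen over [(xi, 0)], where [xi] represents the restriction of [beta] to
    the fibre. It has the same vertical covector part as [(a, beta)], so the
    difference lies in the annihilator. *)
Lemma morse_family_E_h_to_l : morse_family (@fst E (dual R E)) (E_h_to_l h).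
Proof.
split; first exact: smooth_E_h_to_l.
rewrite vertical_annihilator_fst; move=> _ [[p _ <-] pV] [a beta].
pose xi := J (clinear_comp beta (clinear_inr E (dual R E))).
pose u : E * dual R E := (xi, 0).
pose psi p := (p, frechet (E_h_to_l h) p).
have dpsi : is_diff p psi (fun v => (v, frechet (frechet (E_h_to_l h)) p v)).
  have d1 := is_diff_clinear (clinear_id (E * dual R E)%type) p.
  have d2 := frechet_is_diff ((smooth_E_h_to_l 2).2.1 p I).
  exact: is_diff_pair d1 d2.
exists (u, frechet (frechet (E_h_to_l h)) p u).
exists (a - u, beta - frechet (frechet (E_h_to_l h)) p u); split; last first.
- by congr (_, _); rewrite /= addrC subrK.
- apply: tangent_subspace.
  + move=> t y z yV zV nu.
    by rewrite /= [LHS](_ : _ = y.2 (0, nu) + t *: z.2 (0, nu))// yV zV scaler0 addr0.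
  + exact: pV.
  + move=> nu; rewrite /= [LHS](_ : _ = beta (0, nu) -
      frechet (frechet (E_h_to_l h)) p u (0, nu)); last by [].
    rewrite frechet2_E_h_to_lE /=.
    rewrite -[nu xi]/(bidual_point xi nu) J_bidual /=.
    by rewrite !linear0 addr0 [X in _ - (_ + X)](_ : _ = 0) ?addr0 ?subrr.
exact: tangent_range dpsi.
Qed.

(** Testing the defining equation on [(a, 0)] identifies the covector with the fibre
    coordinate; testing it on [(0, nu)] identifies [xi] with the derivative of
    [h]. *)
Lemma generated_E_h_to_l :
  s_cotangent h = generated_set (@fst E (dual R E)) (E_h_to_l h).
Proof.
rewrite s_cotangentE; apply/seteqP; split=> [_ [mu _ <-]|[x mu] [p [/= xE dE]]].
  exists (legendre mu, mu); split=> //; apply: clinearP => -[a nu].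
  rewrite frechet_E_h_to_lE frechet_fst /=.
  by rewrite -[nu (legendre mu)]/(bidual_point (J _) nu) J_bidual addrAC subrr add0r.
have {}dE (w : E * dual R E) : mu w.1 = w.2 p.1 + p.2 w.1 - frechet h p.2 w.2.
  by rewrite -frechet_E_h_to_lE -dE frechet_fst.
have muE : mu = p.2.
  by apply: clinearP => a; rewrite (dE (a, 0)) /= linear0 add0r subr0.
exists mu => //; congr (_, _); apply: (can_inj bidual_J); rewrite J_bidual.
apply: clinearP => nu; have := dE (0, nu).
rewrite /= !linear0 addr0 muE xE => /eqP.
by rewrite eq_sym subr_eq0 => /eqP.
Qed.

End LegendreMorseFamily.

Theorem mainTheorem8 (R : realType) (E : completeNormedModType R)
    (G : lieGroup E) (E_reflexive : reflexive_space E)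
    (lambda : dual R E) (h : dual R E -> R^o) (h_smooth : smooth h) :
  [/\ generates (@fst E (dual R E)) (E_h_to_l h) (s_cotangent h),
      kappa G @` s_cotangent h = lie_poisson_set G h &
      kappa G @` s_cotangent h `&` z_d G lambda = s_z_d G lambda h].
Proof.
have [J JK KJ] := bidual_inverse E_reflexive.
have kappaE : kappa G @` s_cotangent h = lie_poisson_set G h.
  by rewrite /s_cotangent image_comp.
split=> //; last by rewrite kappaE.
split.
- exact: (morse_family_E_h_to_l h_smooth JK).
- exact: (lagrangian_s_cotangent h_smooth JK KJ).
- exact: (generated_E_h_to_l h_smooth JK KJ).
Qed.
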